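(* (1) Let $(G,\alpha)$ be a contractible group and let $G(\alpha)$ be the associated idempotent right quasigroup. Then $$\lim_{k\to\infty} v -^{x}_{k} u = x\,u^{-1}\,v,\qquad \lim_{k\to\infty} u +^{x}_{k} v = u\,x^{-1}\,v,$$ uniformly with respect to $x,u,v$ in a compact set. (2) Let $G$ be a locally compact group which admits a contractive automorphism group $T=(\tau_t)_{t>0}$, and for any $t>0$ consider the idempotent right quasigroup $G(\tau_t)$, with associated difference and sum operations denoted respectively by $v -^{x}_{t} u$ and $u +^{x}_{t} v$. Then $$\lim_{t\to 0} v -^{x}_{t} u = x\,u^{-1}\,v,\qquad \lim_{t\to 0} u +^{x}_{t} v = u\,x^{-1}\,v,$$ uniformly with respect to $x,u,v$ in a compact set.
   Context: A contractible group is a pair $(G,\alpha)$, where $G$ is a topological group with neutral element $e$ and $\alpha\in \mathrm{Aut}(G)$ is a group automorphism, continuous with continuous inverse, such that $\lim_{n\to\infty}\alpha^n(x)=e$ for every $x\in G$. The paper takes as a standing property of contractible groups that $\alpha$ is compactly contractive: for each compact set $K\subset G$ and each open set $U\subset G$ with $e\in U$ there is $N(K,U)\in\mathbb{N}$ such that $\alpha^n(x)\in U$ for all $x\in K$ and all $n\ge N(K,U)$. An automorphism group on a locally compact group $G$ is a family $T=(\tau_t)_{t>0}$ in $\mathrm{Aut}(G)$ (automorphisms of the topological group $G$) with $\tau_t\tau_s=\tau_{ts}$ for all $t,s>0$; it is contractive if $\lim_{t\to0}\tau_t(x)=e$ for every $x\in G$. An idempotent right quasigroup (irq) $(X,\circ,\bullet)$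 is a set with two binary operations such that $x\circ(x\bullet y)=x\bullet(x\circ y)=y$ and $x\circ x=x\bullet x=x$ for all $x,y$. For a group $G$ and a bijection $\delta:G\to G$ with $\delta(e)=e$, $G(\delta)$ is the irq $(G,\circ,\bullet)$ with $x\circ u = x\,\delta(x^{-1}u)$ and $x\bullet u = x\,\delta^{-1}(x^{-1}u)$. In any irq, for integers $k\geq 1$: $x\circ_1u=x\circ u$, $x\bullet_1u=x\bullet u$, $x\circ_{k+1}u=x\circ(x\circ_k u)$, $x\bullet_{k+1}u=x\bullet(x\bullet_k u)$; and $$v -^{x}_{k} u := (x\circ_k u)\bullet_k(x\circ_k v),\qquad u +^{x}_{k} v := x\bullet_k\big((x\circ_k u)\circ_k v\big).$$ In part (2), $v -^{x}_{t} u := (x\circ u)\bullet(x\circ v)$ and $u +^{x}_{t} v := x\bullet\big((x\circ u)\circ v\big)$, computed with the operations $\circ,\bullet$ of $G(\tau_t)$. *)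

(* Defs.v *)
From HB Require Import structures.
From mathcomp Require Import all_boot all_order all_algebra.
From mathcomp Require Import all_classical all_reals all_analysis.
Set Implicit Arguments.
Unset Strict Implicit.
Unset Printing Implicit Defensive.
Import Order.TTheory GRing.Theory Num.Theory.
Import numFieldNormedType.Exports.
Local Open Scope classical_set_scope.
Local Open Scope group_scope.

#[short(type="preTopologicalGroupType")]
HB.structure Definition PreTopologicalGroup := {G of Topological G & Group G}.

HB.mixin Record PreTopologicalGroup_isTopologicalGroup G
    & PreTopologicalGroup G := {
  mulg_continuous : continuous (fun p : G * G => p.1 * p.2) ;
  invg_continuous : continuous (fun x : G => x^-1) }.

(* Not assumed to be Hausdorff. *)
#[short(type="topologicalGroupType")]
HB.structure Definition TopologicalGroup :=
  {G of PreTopologicalGroup G & PreTopologicalGroup_isTopologicalGroup G}.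

Record irq (X : Type) := Irq {
  circ : X -> X -> X ;
  bullet : X -> X -> X ;
  circK : forall x y, circ x (bullet x y) = y ;
  bulletK : forall x y, bullet x (circ x y) = y ;
  circxx : forall x, circ x x = x ;
  bulletxx : forall x, bullet x x = x }.

Section IrqOperations.
Variables (X : Type) (Q : irq X).

(* Meant for k >= 1; circn 0 and bulletn 0 are the second projection. *)
Definition circn (k : nat) (x u : X) : X := iter k (circ Q x) u.
Definition bulletn (k : nat) (x u : X) : X := iter k (bullet Q x) u.

(* irq_difn k x v u is v -^x_k u and irq_sumn k x u v is u +^x_k v. *)
Definition irq_difn (k : nat) (x v u : X) : X :=
  bulletn k (circn k x u) (circn k x v).
Definition irq_sumn (k : nat) (x u v : X) : X :=
  bulletn k x (circn k (circn k x u) v).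

Definition irq_dif (x v u : X) : X := bullet Q (circ Q x u) (circ Q x v).
Definition irq_sum (x u v : X) : X := bullet Q x (circ Q (circ Q x u) v).

End IrqOperations.

Section GroupIrq.
Variables (G : groupType) (delta delta_inv : G -> G).
Hypotheses (deltaK : cancel delta delta_inv) (delta_invK : cancel delta_inv delta).
Hypothesis delta1 : delta 1 = 1.

Let gcirc (x u : G) : G := x * delta (x^-1 * u).
Let gbullet (x u : G) : G := x * delta_inv (x^-1 * u).

Let gcircK x y : gcirc x (gbullet x y) = y.
Proof. by rewrite /gcirc /gbullet mulKg delta_invK mulVKg. Qed.

Let gbulletK x y : gbullet x (gcirc x y) = y.
Proof. by rewrite /gcirc /gbullet mulKg deltaK mulVKg. Qed.

Let gcircxx x : gcirc x x = x.
Proof. by rewrite /gcirc mulVg delta1 mulg1. Qed.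

Let gbulletxx x : gbullet x x = x.
Proof. by rewrite /gbullet mulVg -[X in delta_inv X]delta1 deltaK mulg1. Qed.

Definition group_irq : irq G := Irq gcircK gbulletK gcircxx gbulletxx.

End GroupIrq.

Record top_aut (G : topologicalGroupType) := TopAut {
  aut_fun :> G -> G ;
  aut_inv : G -> G ;
  aut_funK : cancel aut_fun aut_inv ;
  aut_invK : cancel aut_inv aut_fun ;
  autM : {morph aut_fun : x y / x * y} ;
  aut_fun_continuous : continuous aut_fun ;
  aut_inv_continuous : continuous aut_inv }.

Lemma aut1 (G : topologicalGroupType) (a : top_aut G) : a 1 = 1.
Proof. by apply: (mulgI (a 1)); rewrite -autM !mulg1. Qed.

Definition aut_irq (G : topologicalGroupType) (a : top_aut G) : irq G :=
  group_irq (@aut_funK _ a) (@aut_invK _ a) (aut1 a).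

(* Compact contractivity is a standing assumption on contractible groups, hence
   a field here; it is not a consequence of pointwise contractivity for a
   general topological group. *)
Record contractible_group (G : topologicalGroupType) (a : top_aut G) : Prop := {
  contractible_cvg : forall x : G, iter n a x @[n --> \oo] --> (1 : G) ;
  contractible_compact : forall K U : set G, compact K -> open U -> U 1 ->
    exists N : nat, forall (n : nat) (x : G), (N <= n)%N -> K x -> U (iter n a x) }.

(* A family indexed by the positive reals is encoded as a total function, whose
   values at t <= 0 play no role. *)
Definition automorphism_group (R : realType) (G : topologicalGroupType)
    (T : R -> top_aut G) : Prop :=
  forall t s : R, (0 < t)%R -> (0 < s)%R -> forall x : G, T t (T s x) = T (t * s)%R x.

Definition contractive_family (R : realType) (G : topologicalGroupType)
    (T : R -> top_aut G) : Prop :=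
  forall x : G, T t x @[t --> (0%R : R)^'+] --> (1 : G).

(* Uniform convergence on A for both the left and the right uniformity of G. *)
Definition uniform_cvg_on (I S : Type) (F : set_system I)
    (G : topologicalGroupType) (A : set S) (f : I -> S -> G) (g : S -> G) : Prop :=
  forall U : set G, nbhs (1 : G) U ->
    \forall i \near F, forall s, A s ->
      U ((g s)^-1 * f i s) /\ U (f i s * (g s)^-1).

(* Main.v *)
Require Import Defs.
From mathcomp Require Import all_boot all_order all_algebra.
From mathcomp Require Import all_classical all_reals all_analysis.
Import Order.TTheory GRing.Theory Num.Theory.
Import numFieldNormedType.Exports.
Set Implicit Arguments.
Unset Strict Implicit.
Unset Printing Implicit Defensive.
Local Open Scope classical_set_scope.
Local Open Scope group_scope.

(** For an automorphism [d] the operations of [G(d)] simplify to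
    [v - u = x d(x^-1 u) u^-1 v] and [u + v = u d(u^-1 x) x^-1 v] at the base
    point [x]; in particular the sum at [x] is the difference at [u] with
    subtrahend [x] ([irq_sum_aut]). The difference deviates from [x u^-1 v], on
    the left and on the right, by conjugates of [d(x^-1 u)] by [v^-1 u] and by
    [x]. As [x], [u], [v] run over a compact set, these conjugating elements
    stay in a compact set, so a small [d(x^-1 u)] has uniformly small conjugates
    ([compact_conjg]). Hence both limits hold for every family of automorphisms
    that tends to [1] uniformly on compact sets ([irq_dif_sum_uniform_cvg]).

    In part (1) the [k]-fold operations of [G(alpha)] are the operations of
    [G(alpha^k)], and uniform convergence on compact sets is part of the
    hypotheses.

    In part (2) it follows from pointwise convergence by a Banach-Steinhaus
    argument. For a closed neighbourhood [V] of [1], the sets of those [x] with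
    [tau_t x] in [V] for all [0 < t < 1 / (n + 1)] are closed and cover [G]. A
    topological group is regular, and a locally compact regular space is a Baire
    space, so one of these sets has an interior point; translating it to [1]
    gives equicontinuity at [1] ([contractive_equicontinuous]), and a covering
    argument gives uniformity on compact sets
    ([contractive_compactly_contractive]). *)

(** * Neighbourhoods in topological groups *)

Section TopologicalGroupTheory.
Context {G : topologicalGroupType}.

Lemma cvg_mulg {I : Type} {F : set_system I} {FF : Filter F} (f g : I -> G)
    (a b : G) :
  f @ F --> a -> g @ F --> b -> (fun i => f i * g i) @ F --> a * b.
Proof. exact: (continuous2_cvg _ (mulg_continuous (a, b))). Qed.

Lemma cvg_invg {I : Type} {F : set_system I} {FF : Filter F} (f : I -> G)
    (a : G) :
  f @ F --> a -> (fun i => (f i)^-1) @ F --> a^-1.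
Proof. exact: (continuous_cvg _ (@invg_continuous G a)). Qed.

Lemma near1_mulgl (a : G) (U : set G) :
  nbhs a U -> \forall v \near (1 : G), U (a * v).
Proof.
have : a * v @[v --> (1 : G)] --> a * 1 by apply: cvg_mulg => //; exact: cvg_cst.
by rewrite mulg1; exact.
Qed.

Lemma near_mulVg (a : G) (U : set G) :
  nbhs (1 : G) U -> \forall x \near a, U (a^-1 * x).
Proof.
have : a^-1 * x @[x --> a] --> a^-1 * a by apply: cvg_mulg => //; exact: cvg_cst.
by rewrite mulVg; exact.
Qed.

Lemma nbhs1_mulg_split (U : set G) : nbhs (1 : G) U ->
  exists2 V, nbhs (1 : G) V & forall a b, V a -> V b -> U (a * b).
Proof.
move=> U1; have : p.1 * p.2 @[p --> ((1, 1) : G * G)] --> (1 * 1 : G).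
  by apply: cvg_mulg; [exact: cvg_fst | exact: cvg_snd].
rewrite mulg1 => /(_ _ U1) [[A B] /= [A1 B1] AB].
exists (A `&` B); first exact: filterI.
by move=> a b [Aa _] [_ Bb]; exact: (AB (a, b)).
Qed.

Lemma nbhs1_mulVg_split (U : set G) : nbhs (1 : G) U ->
  exists2 V, nbhs (1 : G) V & forall a b, V a -> V b -> U (a^-1 * b).
Proof.
move=> /nbhs1_mulg_split[V V1 VU].
exists (V `&` (fun a => V a^-1)).
  apply: filterI => //.
  have : a^-1 @[a --> (1 : G)] --> (1^-1 : G) by exact: invg_continuous.
  by rewrite invg1; exact.
by move=> a b [_ Va] [Vb _]; exact: VU.
Qed.

Lemma topological_group_regular : regular_space G.
Proof.
move=> a U /near1_mulgl /nbhs1_mulVg_split[V V1 VU].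
(* With [x^-1 * a] instead of [a^-1 * x], a point [x] of the closure and a
   nearby [y] give [a^-1 * x] as the product [(y^-1 * a)^-1 * (y^-1 * x)]. *)
exists [set x | V (x^-1 * a)].
  have : x^-1 * a @[x --> a] --> a^-1 * a.
    by apply: cvg_mulg; [exact/cvg_invg | exact: cvg_cst].
  by rewrite mulVg; exact.
move=> x xV.
have : nbhs x [set y | V (y^-1 * x)].
  have : y^-1 * x @[y --> x] --> x^-1 * x.
    by apply: cvg_mulg; [exact/cvg_invg | exact: cvg_cst].
  by rewrite mulVg; exact.
move=> /xV[y [/= Vya Vyx]].
by have := VU _ _ Vya Vyx; rewrite invgM invgK -mulgA mulVKg mulVKg.
Qed.

(** Elements close to [1] have uniformly small conjugates by the elements of a
    compact set. *)
Lemma compact_conjg (D : set G) (U : set G) : compact D -> nbhs (1 : G) U ->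
  \forall w \near (1 : G), forall d, D d -> U (d * w * d^-1).
Proof.
move=> /compact_near_coveringP cD U1.
apply: (cD _ _ (fun w d => U (d * w * d^-1))) => d Dd.
have : p.1 * p.2 * p.1^-1 @[p --> ((d, 1) : G * G)] --> d * 1 * d^-1.
  apply: cvg_mulg; last by apply: cvg_invg; exact: cvg_fst.
  by apply: cvg_mulg; [exact: cvg_fst | exact: cvg_snd].
by rewrite mulg1 mulgV; exact.
Qed.

End TopologicalGroupTheory.

(** * The Baire property *)

(** No separation beyond regularity is needed: the nested sets have their
    closures, rather than themselves, contained in the previous set, and a
    cluster point of a sequence chosen in them lies in all these closures. *)
Lemma regular_locally_compact_Baire (X : topologicalType) (C : nat -> set X) :
  regular_space X -> locally_compact [set: X] -> [set: X] !=set0 ->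
  (forall n, closed (C n)) -> \bigcup_n C n = setT ->
  exists n, (C n)° !=set0.
Proof.
move=> regX lcX [x0 _] clC covC; apply: contrapT => noint.
have intC n (x : X) : ~ nbhs x (C n) by move=> Cnx; apply: noint; exists n, x.
have [K KT [cK _]] := lcX x0 I.
have K0 : nbhs x0 K.
  by apply: filterS (KT : nbhs x0 (fun y => [set: X] y -> K y)) => y; exact.
(* [next (n, O)] is an open set whose closure is inside [O] and avoids [C n]. *)
have /choice[next nextP] (p : nat * set X) : exists O',
    open p.2 -> p.2 !=set0 -> [/\ open O', O' !=set0 & closure O' `<=` p.2 `\` C p.1].
  case: p => n O /=.
  have [[oO [x Ox]]|nO] := pselect (open O /\ O !=set0); last first.
    by exists O => oO O0; case: nO.
  have [y [Oy nCy]] : exists y, (O `\` C n) y.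
    apply: contrapT => nO; apply: (intC n x).
    apply: filterS (open_nbhs_nbhs (conj oO Ox)) => y Oy.
    by apply: contrapT => nCy; apply: nO; exists y.
  have /regX[B By BO] : nbhs y (O `\` C n).
    by apply: open_nbhs_nbhs; split=> //; apply: openI => //; exact: closed_openC.
  exists B° => _ _; split; [exact: open_interior | by exists y |].
  by apply: subset_trans BO; apply: closureS; exact: interior_subset.
pose O := nat_rect _ K° (fun n On => next (n, On)).
have oO n : open (O n) /\ O n !=set0.
  elim: n => [|n [oOn On0]] /=.
    by split; [exact: open_interior | exists x0].
  by have [] := nextP (n, O n) oOn On0.
have clO n : closure (O n.+1) `<=` O n `\` C n.
  by have [oOn On0] := oO n; have [] := nextP (n, O n) oOn On0.
have subO m n : (m <= n)%N -> O n `<=` O m.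
  elim: n => [|n IHn]; first by rewrite leqn0 => /eqP ->.
  rewrite leq_eqVlt => /predU1P[-> //|/IHn]; apply: subset_trans.
  by move=> y /subset_closure/clO[].
have /choice[z zO] n : exists z, O n z by have [] := oO n.
have [|p [_ zp]] := cK (z @ \oo) _.
  exists 0%N => // n _ /=; apply: (@interior_subset _ K).
  exact: (subO 0%N n isT _ (zO n)).
have pO n : closure (O n) p.
  move=> U pU; have := zp (O n) U; apply => //.
  by exists n => // m /= nm; exact: subO nm _ (zO m).
have [n _ Cnp] : (\bigcup_n C n) p by rewrite covC.
by have [_] := clO n _ (pO n.+1).
Qed.

(** * From pointwise to compact contractivity *)

(** Uniform convergence to [1] along [F] on every compact set. *)
Definition compactly_contractive (I : Type) (F : set_system I)
    (G : topologicalGroupType) (delta : I -> G -> G) : Prop :=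
  forall C W : set G, compact C -> nbhs (1 : G) W ->
    \forall i \near F, forall c, C c -> W (delta i c).

(** The hypothesis on [B] replaces [F] by countably many index sets, so that the
    Baire property applies; then one of them works for a neighbourhood of [1]. *)
Lemma contractive_equicontinuous (I : Type) (F : set_system I) (B : nat -> set I)
    (G : topologicalGroupType) (delta : I -> top_aut G) :
  (forall A, F A -> exists n, B n `<=` A) ->
  locally_compact [set: G] ->
  (forall x, delta i x @[i --> F] --> (1 : G)) ->
  forall W : set G, nbhs (1 : G) W ->
    exists n, \forall v \near (1 : G), forall i, B n i -> W (delta i v).
Proof.
move=> baseB lcG ptw W /nbhs1_mulVg_split[U U1 UW].
have [V V1 VU] := topological_group_regular U1.
pose C n := \bigcap_(i in B n) (delta i @^-1` closure V).
have clC n : closed (C n).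
  apply: closed_bigI => i _; apply: preimage_closed; last exact: closed_closure.
  by move=> x _; exact: aut_fun_continuous.
have covC : \bigcup_n C n = setT.
  rewrite -subTset => x _.
  have [n Bn] := baseB _ (ptw x _ V1).
  by exists n => // i /Bn /=; exact: subset_closure.
have [|n [x Cnx]] := regular_locally_compact_Baire topological_group_regular
  lcG _ clC covC; first by exists 1.
exists n; have := near1_mulgl Cnx; apply: filterS => v Cxv i Bi.
have Cx := nbhs_singleton Cnx.
rewrite -(mulKg (delta i x) (delta i v)) -autM.
by apply: UW; apply: VU; [exact: Cx | exact: Cxv].
Qed.

(** Near [x], writing [y = x (x^-1 y)] splits [delta i y] into [delta i x],
    small by pointwise convergence, and [delta i (x^-1 y)], small by
    equicontinuity. *)
Lemma contractive_compactly_contractive (I : Type) (F : set_system I)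
    {FF : Filter F} (B : nat -> set I) (G : topologicalGroupType)
    (delta : I -> top_aut G) :
  (forall n, F (B n)) -> (forall A, F A -> exists n, B n `<=` A) ->
  locally_compact [set: G] ->
  (forall x, delta i x @[i --> F] --> (1 : G)) ->
  compactly_contractive F (fun i => delta i).
Proof.
move=> FB baseB lcG ptw C W /compact_near_coveringP cC /nbhs1_mulg_split[V V1 VW].
apply: (cC _ _ (fun i c => W (delta i c))) => x Cx.
have [n /near_mulVg eqV] := contractive_equicontinuous baseB lcG ptw V1.
exists ([set y | forall i, B n i -> V (delta i (x^-1 * y))],
        B n `&` [set i | V (delta i x)]).
  by split; [exact: eqV | apply: filterI => //; exact: ptw].
move=> [y i] /= [Vy [Bi Vx]].
by rewrite -(mulVKg x y) autM; apply: VW => //; exact: Vy.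
Qed.

(** * Differences and sums in the irq of an automorphism *)

Section IrqLimits.
Context {G : topologicalGroupType}.

Lemma autV (a : top_aut G) x : a x^-1 = (a x)^-1.
Proof. by apply: (mulgI (a x)); rewrite -autM !mulgV aut1. Qed.

Lemma irq_dif_aut (a : top_aut G) x v u :
  irq_dif (aut_irq a) x v u = x * a (x^-1 * u) * u^-1 * v.
Proof.
rewrite /irq_dif /= invgM -(mulgA _ x^-1) mulKg -autV -autM aut_funK.
by rewrite invgM invgK -(mulgA _ x) mulVKg mulgA.
Qed.

(** The sum of [u] and [v] based at [x] is the difference of [v] and [x] based
    at [u]. *)
Lemma irq_sum_aut (a : top_aut G) x u v :
  irq_sum (aut_irq a) x u v = irq_dif (aut_irq a) u v x.
Proof.
rewrite irq_dif_aut /irq_sum /= -(mulgA x) mulKg -autM aut_funK -(mulgA x^-1).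
by rewrite mulVKg invgM -autV invgM invgK !mulgA.
Qed.

Lemma compact_mulVg (K : set G) : compact K ->
  compact [set p.1^-1 * p.2 | p in K `*` K].
Proof.
move=> cK; apply: continuous_compact; last exact: compact_setX.
apply: continuous_subspaceT => p.
by apply: cvg_mulg; [apply: cvg_invg; exact: cvg_fst | exact: cvg_snd].
Qed.

Lemma irq_dif_sum_uniform_cvg (I : Type) (F : set_system I) {FF : Filter F}
    (delta : I -> top_aut G) (K : set G) :
  compactly_contractive F (fun i => delta i) -> compact K ->
  uniform_cvg_on F (K `*` K `*` K)
    (fun i '(x, u, v) => irq_dif (aut_irq (delta i)) x v u)
    (fun '(x, u, v) => x * u^-1 * v) /\
  uniform_cvg_on F (K `*` K `*` K)
    (fun i '(x, u, v) => irq_sum (aut_irq (delta i)) x u v)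
    (fun '(x, u, v) => u * x^-1 * v).
Proof.
move=> contr cK.
suff dif : uniform_cvg_on F (K `*` K `*` K)
    (fun i '(x, u, v) => irq_dif (aut_irq (delta i)) x v u)
    (fun '(x, u, v) => x * u^-1 * v).
  split=> // U U1; have := dif U U1; apply: filterS => i difi.
  move=> [[x u] v] [[Kx Ku] Kv]; cbv beta iota; rewrite irq_sum_aut.
  exact: (difi (u, x, v)).
move=> U U1; pose KVK := [set p.1^-1 * p.2 | p in K `*` K].
have KVKP x y : K x -> K y -> KVK (x^-1 * y) by move=> Kx Ky; exists (x, y).
have cKVK : compact KVK by exact: compact_mulVg.
have := contr _ _ cKVK (compact_conjg (compactU cK cKVK) U1).
apply: filterS => i Ui [[x u] v] [[Kx Ku] Kv].
cbv beta iota; rewrite irq_dif_aut; set w := delta i _.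
have {}Ui d : (K `|` KVK) d -> U (d * w * d^-1) by apply: Ui; exact: KVKP.
split.
- have -> : (x * u^-1 * v)^-1 * (x * w * u^-1 * v) =
            (v^-1 * u) * w * (v^-1 * u)^-1.
    by rewrite !invgM !invgK -!mulgA mulKg.
  by apply: Ui; right; exact: KVKP.
- have -> : x * w * u^-1 * v * (x * u^-1 * v)^-1 = x * w * x^-1.
    by rewrite !invgM !invgK -!mulgA mulVKg mulKg.
  by apply: Ui; left.
Qed.

End IrqLimits.

(** * Iterates of an automorphism *)

Lemma iter_can (T : Type) (f g : T -> T) (n : nat) :
  cancel f g -> cancel (iter n f) (iter n g).
Proof. by move=> fK; elim: n => // n IHn x; rewrite iterSr iterS fK IHn. Qed.

Lemma iter_continuous (X : topologicalType) (f : X -> X) (n : nat) :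
  continuous f -> continuous (iter n f).
Proof.
move=> cf; elim: n => [|n IHn] x; first exact: cvg_id.
exact: (continuous_comp (IHn x) (cf _)).
Qed.

Lemma iter_morphM (G : groupType) (f : G -> G) (n : nat) :
  {morph f : x y / x * y} -> {morph iter n f : x y / x * y}.
Proof. by move=> fM x y; elim: n => // n IHn; rewrite !iterS IHn fM. Qed.

(** The [n]-th iterate of [a], as an automorphism of the topological group. *)
Definition iter_aut (G : topologicalGroupType) (a : top_aut G) (n : nat) :
    top_aut G :=
  TopAut (@iter_can _ _ _ n (@aut_funK _ a)) (@iter_can _ _ _ n (@aut_invK _ a))
    (@iter_morphM _ _ n (@autM _ a))
    (@iter_continuous _ _ n (@aut_fun_continuous _ a))
    (@iter_continuous _ _ n (@aut_inv_continuous _ a)).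

Lemma circn_aut (G : topologicalGroupType) (a : top_aut G) (n : nat) x u :
  circn (aut_irq a) n x u = circ (aut_irq (iter_aut a n)) x u.
Proof.
rewrite /circn /=; elim: n => [|n IHn]; first by rewrite /= mulVKg.
by rewrite !iterS IHn mulKg.
Qed.

Lemma bulletn_aut (G : topologicalGroupType) (a : top_aut G) (n : nat) x u :
  bulletn (aut_irq a) n x u = bullet (aut_irq (iter_aut a n)) x u.
Proof.
rewrite /bulletn /=; elim: n => [|n IHn]; first by rewrite /= mulVKg.
by rewrite !iterS IHn mulKg.
Qed.

Lemma irq_difn_aut (G : topologicalGroupType) (a : top_aut G) n x v u :
  irq_difn (aut_irq a) n x v u = irq_dif (aut_irq (iter_aut a n)) x v u.
Proof. by rewrite /irq_difn bulletn_aut !circn_aut. Qed.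

Lemma irq_sumn_aut (G : topologicalGroupType) (a : top_aut G) n x u v :
  irq_sumn (aut_irq a) n x u v = irq_sum (aut_irq (iter_aut a n)) x u v.
Proof. by rewrite /irq_sumn bulletn_aut !circn_aut. Qed.

(** * Limits of differences and sums *)

Theorem proposition4p5 :
  (forall (G : topologicalGroupType) (alpha : top_aut G),
     contractible_group alpha ->
     forall K : set G, compact K ->
       uniform_cvg_on \oo (K `*` K `*` K)
         (fun (k : nat) '(x, u, v) => irq_difn (aut_irq alpha) k x v u)
         (fun '(x, u, v) => x * u^-1 * v) /\
       uniform_cvg_on \oo (K `*` K `*` K)
         (fun (k : nat) '(x, u, v) => irq_sumn (aut_irq alpha) k x u v)
         (fun '(x, u, v) => u * x^-1 * v)) /\
  (forall (R : realType) (G : topologicalGroupType) (T : R -> top_aut G),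
     locally_compact [set: G] ->
     automorphism_group T ->
     contractive_family T ->
     forall K : set G, compact K ->
       uniform_cvg_on (0%R : R)^'+ (K `*` K `*` K)
         (fun (t : R) '(x, u, v) => irq_dif (aut_irq (T t)) x v u)
         (fun '(x, u, v) => x * u^-1 * v) /\
       uniform_cvg_on (0%R : R)^'+ (K `*` K `*` K)
         (fun (t : R) '(x, u, v) => irq_sum (aut_irq (T t)) x u v)
         (fun '(x, u, v) => u * x^-1 * v)).
Proof.
split=> [G alpha [_ calpha] K cK | R G T lcG _ cT K cK].
  have contr : compactly_contractive \oo (fun n => iter_aut alpha n).
    move=> C W cC W1.
    have [N HN] := calpha C W° cC (open_interior W) W1.
    by exists N => // n /= Nn c Cc; apply: (@interior_subset _ W); exact: HN.
  have [dif sum] := irq_dif_sum_uniform_cvg contr cK; split=> U U1.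
    apply: filterS (dif U U1) => n + [[x u] v] => /(_ (x, u, v)); cbv beta iota.
    by rewrite irq_difn_aut.
  apply: filterS (sum U U1) => n + [[x u] v] => /(_ (x, u, v)); cbv beta iota.
  by rewrite irq_sumn_aut.
apply: irq_dif_sum_uniform_cvg cK.
(* The intervals ]0, 1 / (n + 1)[ form a countable base of the filter of right
   neighbourhoods of 0. *)
pose B (n : nat) := [set t : R | (0 < t < n.+1%:R^-1)%R].
apply: (contractive_compactly_contractive (B := B)) => //.
  move=> n; near=> t; apply/andP; split; near: t; first exact: nbhs_right_gt.
  exact: nbhs_right_lt.
move=> A [e /= e0 eA].
have [n ne] : exists n : nat, (n.+1%:R^-1 < e)%R.
  by have [n] := ltr_add_invr e0; rewrite add0r => ne; exists n.
exists n => t /andP[t0 tn]; apply: eA => //=.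
rewrite sub0r normrN gtr0_norm //; exact: lt_trans tn ne.
Unshelve. all: by end_near.
Qed.
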